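(* The overpassing bonds $b_{ij}$, $1\le i<j\le n$, constitute a sufficient set of bond generators for the bonded braid monoid $BB_n$; that is, $BB_n$ is generated as a monoid by the elements $\sigma_1^{\pm1},\dots,\sigma_{n-1}^{\pm1}$ together with the bonds $b_{ij}=b_{ij}^{\emptyset}$, $1\le i<j\le n$.
   Context: The bonded braid monoid $BB_n$ is the monoid generated by $\sigma_i^{\pm1}$ ($1\le i\le n-1$) and the bonds $b_{ij}^{\mathcal I}$ for $1\le i<j\le n$ and $\mathcal I\subseteq\{i+1,\dots,j-1\}$ (the set of indices of the strands the bond passes under); write $b_{ij}=b_{ij}^{\emptyset}$ (uniform overpassing bond) and $b_i=b_{i,i+1}$. The defining relations are $\sigma_i\sigma_i^{-1}=\sigma_i^{-1}\sigma_i=1$ and: 1) $\sigma_i\sigma_j=\sigma_j\sigma_i$ for $|i-j|>1$. 2) $\sigma_i\sigma_{i+1}\sigma_i=\sigma_{i+1}\sigma_i\sigma_{i+1}$ for all $i$. 3) $b_{ij}^{\mathcal I}b_{rs}^{\mathcal R}=b_{rs}^{\mathcal R}b_{ij}^{\mathcal I}$ for $i<j<r<s$ and all $\mathcal I,\mathcal R$. 4) $b_{ij}^{\mathcal I}b_{rs}^{\mathcal R}=b_{rs}^{\mathcal R}b_{ij}^{\mathcal I}$ for $i<r<s<j$ whenever either $r,s\in\mathcal I$ and $\mathcal R\subseteq\mathcal I\cap\{r+1,\dots,s-1\}$, or $r,s\notin\mathcal I$ and $\mathcal I\cap\{r+1,\dots,s-1\}\subseteq\mathcal R$. 5.1) $\sigma_i^{-1}b_{i+1,j}^{\mathcal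 I}\sigma_i=b_{ij}^{\mathcal I}$ for $j-i>1$, $\mathcal I\subseteq\{i+2,\dots,j-1\}$. 5.2) $\sigma_i b_{i+1,j}^{\mathcal I}\sigma_i^{-1}=b_{ij}^{\{i+1\}\cup\mathcal I}$ for $j-i>1$, $\mathcal I\subseteq\{i+2,\dots,j-1\}$. 5.3) $\sigma_{j-1}b_{i,j-1}^{\mathcal I}\sigma_{j-1}^{-1}=b_{ij}^{\mathcal I}$ for $j-i>1$, $\mathcal I\subseteq\{i+1,\dots,j-2\}$. 5.4) $\sigma_{j-1}^{-1}b_{i,j-1}^{\mathcal I}\sigma_{j-1}=b_{ij}^{\mathcal I\cup\{j-1\}}$ for $j-i>1$, $\mathcal I\subseteq\{i+1,\dots,j-2\}$. 6) $\sigma_ib_i=b_i\sigma_i$ for $1\le i\le n-1$. 7) $\sigma_ib_{rs}^{\mathcal R}=b_{rs}^{\mathcal R}\sigma_i$ for $i+1<r$ or $i>s$. 8.1) $\sigma_ib_{rs}^{\mathcal R}=b_{rs}^{\mathcal R}\sigma_i$ for $r<i<s-1$ when $i,i+1\in\mathcal R$ or $i,i+1\notin\mathcal R$. 8.2) $\sigma_ib_{rs}^{\mathcal R}=b_{rs}^{\mathcal R'}\sigma_i$ for $r<i<s-1$, where $\mathcal R,\mathcal R'\subseteq\{r+1,\dots,s-1\}$ are equal except that $i\in\mathcal R$, $i+1\notin\mathcal R$, $i\notin\mathcal R'$, $i+1\in\mathcal R'$. 9.1) $b_i\sigma_{i+1}\sigma_i=\sigma_{i+1}\sigma_ib_{i+1}$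 for $1\le i<n-1$. 9.2) $\sigma_i\sigma_{i+1}b_i=b_{i+1}\sigma_i\sigma_{i+1}$ for $1\le i<n-1$. (All strand indices in $\{1,\dots,n\}$.) *)

(* Defs.v *)
From HB Require Import structures.
From mathcomp Require Import all_boot.
From mathcomp Require Import generic_quotient finmap boolp classical_sets.

Set Implicit Arguments.
Unset Strict Implicit.
Unset Printing Implicit Defensive.

Local Open Scope quotient_scope.
Local Open Scope fset_scope.

(* Strands are numbered from 1 to n, as natural numbers.  [Sig i] and [SigV i] *)
(* stand for sigma_i and sigma_i^-1, and [Bond i j I] for the bond b_ij^I,     *)
(* where I is the set of the strands that the bond passes under.               *)
Inductive letter : Type :=
  | Sig of nat
  | SigV of nat
  | Bond of nat & nat & {fset nat}.

Definition letter_code (a : letter) : nat + nat + nat * nat * {fset nat} :=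
  match a with
  | Sig i => inl (inl i)
  | SigV i => inl (inr i)
  | Bond i j J => inr (i, j, J)
  end.

Definition letter_decode (c : nat + nat + nat * nat * {fset nat}) : letter :=
  match c with
  | inl (inl i) => Sig i
  | inl (inr i) => SigV i
  | inr (i, j, J) => Bond i j J
  end.

Lemma letter_codeK : cancel letter_code letter_decode.
Proof. by case. Qed.

HB.instance Definition _ := Choice.copy letter (can_type letter_codeK).

Definition between (i j : nat) : {fset nat} :=
  [fset k in iota i.+1 (j - i.+1)].

Lemma in_between (i j k : nat) : (k \in between i j) = (i < k < j).
Proof.
rewrite !inE mem_iota; case: (ltnP i k) => //= lt_ik.
case: (leqP i.+1 j) => [/subnKC-> //|lt_ji].
have /eqP -> : j - i.+1 == 0 by rewrite subn_eq0 ltnW.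
rewrite addn0 ltnNge lt_ik; apply/esym/negbTE; rewrite -leqNgt.
exact: leq_trans (ltnW lt_ji) lt_ik.
Qed.

Definition is_generator (n : nat) (a : letter) : bool :=
  match a with
  | Sig i | SigV i => 1 <= i < n
  | Bond i j J => [&& 1 <= i, i < j, j <= n & J `<=` between i j]
  end.

Definition generator (n : nat) : Type := {a : letter | is_generator n a}.

(* The bounds involving n are not repeated here: in [bb_eq] below, a defining  *)
(* relation is used only when all the letters on both sides are generators.    *)
Inductive bb_rel : seq letter -> seq letter -> Prop :=
  | rel_sigK i : bb_rel [:: Sig i; SigV i] [::]
  | rel_sigVK i : bb_rel [:: SigV i; Sig i] [::]
  | rel1 i j : (i.+1 < j) || (j.+1 < i) ->
      bb_rel [:: Sig i; Sig j] [:: Sig j; Sig i]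
  | rel2 i :
      bb_rel [:: Sig i; Sig i.+1; Sig i] [:: Sig i.+1; Sig i; Sig i.+1]
  | rel3 i j r s I R : i < j -> j < r -> r < s ->
      bb_rel [:: Bond i j I; Bond r s R] [:: Bond r s R; Bond i j I]
  | rel4 i j r s I R : i < r -> r < s -> s < j ->
      ([/\ r \in I, s \in I & R `<=` I `&` between r s] \/
       [/\ r \notin I, s \notin I & I `&` between r s `<=` R]) ->
      bb_rel [:: Bond i j I; Bond r s R] [:: Bond r s R; Bond i j I]
  | rel5_1 i j I : i.+1 < j -> I `<=` between i.+1 j ->
      bb_rel [:: SigV i; Bond i.+1 j I; Sig i] [:: Bond i j I]
  | rel5_2 i j I : i.+1 < j -> I `<=` between i.+1 j ->
      bb_rel [:: Sig i; Bond i.+1 j I; SigV i] [:: Bond i j (i.+1 |` I)]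
  | rel5_3 i j I : i.+1 < j -> I `<=` between i j.-1 ->
      bb_rel [:: Sig j.-1; Bond i j.-1 I; SigV j.-1] [:: Bond i j I]
  | rel5_4 i j I : i.+1 < j -> I `<=` between i j.-1 ->
      bb_rel [:: SigV j.-1; Bond i j.-1 I; Sig j.-1] [:: Bond i j (j.-1 |` I)]
  | rel6 i :
      bb_rel [:: Sig i; Bond i i.+1 fset0] [:: Bond i i.+1 fset0; Sig i]
  | rel7 i r s R : (i.+1 < r) || (s < i) ->
      bb_rel [:: Sig i; Bond r s R] [:: Bond r s R; Sig i]
  | rel8_1 i r s R : r < i -> i < s.-1 ->
      (i \in R /\ i.+1 \in R) \/ (i \notin R /\ i.+1 \notin R) ->
      bb_rel [:: Sig i; Bond r s R] [:: Bond r s R; Sig i]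
  | rel8_2 i r s R R' : r < i -> i < s.-1 ->
      i \in R -> i.+1 \notin R -> i \notin R' -> i.+1 \in R' ->
      (forall k, k != i -> k != i.+1 -> (k \in R) = (k \in R')) ->
      bb_rel [:: Sig i; Bond r s R] [:: Bond r s R'; Sig i]
  | rel9_1 i :
      bb_rel [:: Bond i i.+1 fset0; Sig i.+1; Sig i]
             [:: Sig i.+1; Sig i; Bond i.+1 i.+2 fset0]
  | rel9_2 i :
      bb_rel [:: Sig i; Sig i.+1; Bond i i.+1 fset0]
             [:: Bond i.+1 i.+2 fset0; Sig i; Sig i.+1].

Inductive bb_eq (n : nat) : seq (generator n) -> seq (generator n) -> Prop :=
  | bb_eq_rel u v : bb_rel (map val u) (map val v) -> bb_eq u v
  | bb_eq_refl u : bb_eq u u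
  | bb_eq_sym u v : bb_eq u v -> bb_eq v u
  | bb_eq_trans u v w : bb_eq u v -> bb_eq v w -> bb_eq u w
  | bb_eq_cat u u' v v' : bb_eq u u' -> bb_eq v v' -> bb_eq (u ++ v) (u' ++ v').

Section BondedBraidMonoid.

Variable n : nat.

Definition bb_eqb : rel (seq (generator n)) := fun u v => `[< bb_eq u v >].

Lemma bb_eqb_refl : reflexive bb_eqb.
Proof. by move=> u; apply/asboolP/bb_eq_refl. Qed.

Lemma bb_eqb_sym : symmetric bb_eqb.
Proof. by move=> u v; apply/asboolP/asboolP; apply: bb_eq_sym. Qed.

Lemma bb_eqb_trans : transitive bb_eqb.
Proof.
by move=> v u w /asboolP uv /asboolP vw; apply/asboolP/(bb_eq_trans uv vw).
Qed.

Canonical bb_equiv := EquivRel bb_eqb bb_eqb_refl bb_eqb_sym bb_eqb_trans.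

Definition BB := {eq_quot bb_equiv}.
HB.instance Definition _ := Choice.on BB.
HB.instance Definition _ := EqQuotient.on BB.

Definition bb_word (u : seq (generator n)) : BB := \pi_BB u.

Lemma bb_wordP (u v : seq (generator n)) : bb_word u = bb_word v <-> bb_eq u v.
Proof. by split=> [/eqmodP/asboolP//|uv]; apply/eqmodP/asboolP. Qed.

Lemma bb_word_repr (x : BB) : bb_word (repr x) = x.
Proof. exact: reprK. Qed.

Definition bb_one : BB := bb_word [::].
Definition bb_mul (x y : BB) : BB := bb_word (repr x ++ repr y).

Lemma bb_mul_word (u v : seq (generator n)) :
  bb_mul (bb_word u) (bb_word v) = bb_word (u ++ v).
Proof. by apply/bb_wordP/bb_eq_cat; apply/bb_wordP; rewrite bb_word_repr. Qed.

Lemma bb_mulA : associative bb_mul.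
Proof.
move=> x y z; rewrite -[x]bb_word_repr -[y]bb_word_repr -[z]bb_word_repr.
by rewrite !bb_mul_word catA.
Qed.

Lemma bb_mul1 : left_id bb_one bb_mul.
Proof. by move=> x; rewrite -[x]bb_word_repr bb_mul_word. Qed.

Lemma bb_mulr1 : right_id bb_one bb_mul.
Proof. by move=> x; rewrite -[x]bb_word_repr bb_mul_word cats0. Qed.

HB.instance Definition _ := isMonoid.Build BB bb_mulA bb_mul1 bb_mulr1.

Definition sigma (i : nat) (hi : 1 <= i < n) : BB :=
  bb_word [:: exist _ (Sig i) hi].

Definition sigmaV (i : nat) (hi : 1 <= i < n) : BB :=
  bb_word [:: exist _ (SigV i) hi].

Definition bond (i j : nat) (I : {fset nat})
    (h : [&& 1 <= i, i < j, j <= n & I `<=` between i j]) : BB :=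
  bb_word [:: exist _ (Bond i j I) h].

Lemma overpassing_subproof (i j : nat) : [&& 1 <= i, i < j & j <= n] ->
  [&& 1 <= i, i < j, j <= n & fset0 `<=` between i j].
Proof. by case/and3P=> -> -> ->; rewrite fsub0set. Qed.

Definition overpassing_bond (i j : nat) (h : [&& 1 <= i, i < j & j <= n]) : BB :=
  bond (overpassing_subproof h).

Local Open Scope classical_set_scope.

Definition overpassing_generators : set BB :=
  [set x | (exists i (hi : 1 <= i < n), x = sigma hi)
        \/ (exists i (hi : 1 <= i < n), x = sigmaV hi)
        \/ (exists i j (h : [&& 1 <= i, i < j & j <= n]),
              x = overpassing_bond h)].

End BondedBraidMonoid.

Definition generates_monoid (M : monoidType) (G : set M) : Prop :=
  smallest (fun S : set M => monoid_closed [in S]) G = [set: M]%classic.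

(* Main.v *)
(** A bond [b_ij^I] with [i + 1 < j] is a conjugate of a bond [b_{i+1,j}^J] by [sigma_i]
    or its inverse, according to whether [i + 1] lies in [I] (relations 5.1 and 5.2). Induction
    on [j - i] thus reduces every bond to bonds [b_{j-1,j}], which are overpassing. *)
Require Import Defs.
From mathcomp Require Import all_boot.
From mathcomp Require Import finmap boolp classical_sets.

Set Implicit Arguments.
Unset Strict Implicit.
Unset Printing Implicit Defensive.

Local Open Scope fset_scope.
Local Open Scope group_scope.

(** Convertible to the condition that [bond] expects, so a proof of it can be passed to [bond]
    directly. *)
Definition is_bond (n i j : nat) (I : {fset nat}) : bool :=
  [&& 1 <= i, i < j, j <= n & I `<=` between i j].

Lemma between_succD (i j : nat) (I : {fset nat}) :
  I `<=` between i j -> I `\ i.+1 `<=` between i.+1 j.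
Proof.
move=> /fsubsetP sIb; apply/fsubsetP => k.
rewrite in_fsetD1 in_between => /andP[nki /sIb].
by rewrite in_between => /andP[lik ->]; rewrite ltn_neqAle eq_sym nki lik.
Qed.

Lemma between_succ0 (i : nat) (I : {fset nat}) :
  I `<=` between i i.+1 -> I = fset0.
Proof.
move=> /fsubsetP sIb; apply/eqP/fset0Pn => -[k /sIb].
by rewrite in_between => /andP[lik]; rewrite ltnS leqNgt lik.
Qed.

(** Removing [i.+1] in all cases gives one shorter bond that serves both relations 5.1 and 5.2; the
    removal changes nothing when [i.+1] is not in [I]. *)
Lemma is_bond_succ (n i j : nat) (I : {fset nat}) :
  i.+1 < j -> is_bond n i j I -> is_bond n i.+1 j (I `\ i.+1).
Proof. by move=> lij /and4P[_ _ ljn sI]; apply/and4P; rewrite between_succD. Qed.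

Lemma is_bond_sig (n i j : nat) (I : {fset nat}) :
  is_bond n i j I -> 1 <= i < n.
Proof. by case/and4P=> -> lij ljn _; apply: leq_trans ljn. Qed.

Lemma bb_wordM (n : nat) (u v : seq (generator n)) :
  bb_word (u ++ v) = bb_word u * bb_word v.
Proof. by rewrite [RHS]bb_mul_word. Qed.

Lemma bond_conjV (n i j : nat) (I : {fset nat}) (hi : 1 <= i < n)
    (h : is_bond n i j I) (h' : is_bond n i.+1 j (I `\ i.+1)) :
  i.+1 < j -> i.+1 \notin I -> bond h = sigmaV hi * bond h' * sigma hi.
Proof.
move=> lij nI; have sI : I `\ i.+1 `<=` between i.+1 j by case/and4P: h'.
rewrite /bond /sigma /sigmaV -!bb_wordM.
apply/bb_wordP/bb_eq_sym/bb_eq_rel => /=.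
(* Only the set of the long bond is turned back into [I]; the short bond must keep the form it has
   in [h']. *)
by have := rel5_1 lij sI; rewrite {2}mem_fsetD1.
Qed.

Lemma bond_conj (n i j : nat) (I : {fset nat}) (hi : 1 <= i < n)
    (h : is_bond n i j I) (h' : is_bond n i.+1 j (I `\ i.+1)) :
  i.+1 < j -> i.+1 \in I -> bond h = sigma hi * bond h' * sigmaV hi.
Proof.
move=> lij iI; have sI : I `\ i.+1 `<=` between i.+1 j by case/and4P: h'.
rewrite /bond /sigma /sigmaV -!bb_wordM.
apply/bb_wordP/bb_eq_sym/bb_eq_rel => /=.
by have := rel5_2 lij sI; rewrite fsetD1K.
Qed.

Section Closed.

Variables (n : nat) (S : set (BB n)).
Hypotheses (S_closed : monoid_closed [in S])
           (GS : (@overpassing_generators n `<=` S)%classic).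

Lemma closed1 : S 1.
Proof. by case: S_closed => /set_mem. Qed.

Lemma closedM (x y : BB n) : S x -> S y -> S (x * y).
Proof. by case: S_closed => _ SM Sx Sy; apply/set_mem/SM; apply/mem_set. Qed.

Lemma closed_sigma (i : nat) (hi : 1 <= i < n) : S (sigma hi).
Proof. by apply: GS; left; exists i, hi. Qed.

Lemma closed_sigmaV (i : nat) (hi : 1 <= i < n) : S (sigmaV hi).
Proof. by apply: GS; right; left; exists i, hi. Qed.

Lemma closed_bond (i j : nat) (I : {fset nat}) (h : is_bond n i j I) :
  S (bond h).
Proof.
(* The right end [j] stays fixed; [i] and [I] vary, with [d] a strict bound on [j - i]. *)
have [d le_d] := ubnP (j - i); elim: d i I h le_d => // d IHd i I h le_d.
have /and4P[i_gt0 lij ljn sI] := h.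
have hi := is_bond_sig h.
case: (ltngtP i.+1 j) lij => // [lij|eq_j] _; last first.
  have I0 : I = fset0 by apply: (@between_succ0 i); rewrite eq_j.
  have ho : [&& 1 <= i, i < j & j <= n] by rewrite i_gt0 ljn -eq_j ltnSn.
  apply: GS; right; right; exists i, j, ho.
  (* Both sides are now the bond with empty set, up to the proof of a Boolean condition. *)
  by subst I; congr bond; apply: bool_irrelevance.
have h' := is_bond_succ lij h.
have Sb : S (bond h').
  apply: IHd.
  by rewrite ltnS in le_d; apply: leq_trans le_d; rewrite ltn_sub2l // ltnW.
have [iI|nI] := boolP (i.+1 \in I).
  rewrite (bond_conj hi h h' lij iI).
  by apply: closedM (closed_sigmaV hi); apply: closedM Sb; apply: closed_sigma.
rewrite (bond_conjV hi h h' lij nI).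
by apply: closedM (closed_sigma hi); apply: closedM Sb; apply: closed_sigmaV.
Qed.

(** A word is the product of its letters, and bonds are the only letters not covered at once by
    [GS]. *)
Lemma closed_word (u : seq (generator n)) : S (bb_word u).
Proof.
elim: u => [|a u IHu]; first exact: closed1.
rewrite -cat1s bb_wordM; apply: closedM IHu.
case: a => -[i|i|i j I] h; first exact: closed_sigma.
- exact: closed_sigmaV.
- exact: closed_bond.
Qed.

End Closed.

Theorem proposition3p5 (n : nat) : generates_monoid (@overpassing_generators n).
Proof.
(* [smallest] is an intersection, so it is enough to treat an arbitrary closed [S] containing the
   generators. *)
apply/seteqP; split=> // x _ S [S_closed GS].
by rewrite -[x]bb_word_repr; apply: closed_word.
Qed.
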